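(* Fix $\omega$ in the frequency band and $j\in\{1,\ldots,N\}$, and write $\beta_j=\beta_j(\omega)$, $\mathcal{S}_j=\mathcal{S}_j(\omega)$. Set $$ X_{d,j}(\omega)=\ell\sqrt{\frac{3\,\mathcal{S}_j(\omega)}{2Z}} , $$ and consider the low-SNR regime, that is, the limit $\gamma=Z/\mathcal{S}_1(\omega_0)\to\infty$ (equivalently $Z\to\infty$), in which $X_{d,j}(\omega)/\ell\to0$. For $X_1,X_1',X_2,X_2'\in\mathbb{R}$ let $$ E_j(X_1,X_1',X_2,X_2';Z)=\frac{2\pi Z}{\beta_j}\,\mathbb{E}\left[\mathcal{T}_j(\omega,X_1,X_1',Z)\overline{\mathcal{T}_j(\omega,X_2,X_2',Z)}\right]. $$ (i) If $X_1'=X_2'=X'$, the moment is essentially zero unless $|X_1-X_2|/\ell\lesssim\sqrt{3\mathcal{S}_j/Z}\ll1$, in the sense that $$ \lim_{M\to\infty}\ \limsup_{Z\to\infty}\ \sup\Big\{|E_j(X_1,X',X_2,X';Z)|\ :\ X',X_1,X_2\in\mathbb{R},\ |X_1-X_2|\ge M\,\ell\sqrt{3\mathcal{S}_j/Z}\Big\}=0, $$ and the moment formula simplifies to $$ E_j(X_1,X',X_2,X';Z)\approx\exp\left[\frac{i\beta_j[(X_1-X')^2-(X_2-X')^2]}{2Z}-\frac{(X_1-X_2)^2}{2X_{d,j}^2(\omega)}\right], $$ where $\approx$ means that the supremum over $X',X_1,X_2\in\mathbb{R}$ of the modulus of the difference of the two sides tends to $0$ as $Z\to\infty$. (ii) If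 $X_1'$ and $X_2'$ are different but $|X_1'-X_2'|/\ell\ll1$, the moment formula becomes $$ E_j(X_1,X_1',X_2,X_2';Z)\approx\exp\left[\frac{i\beta_j[(X_1-X_1')^2-(X_2-X_2')^2]}{2Z}-\frac{(X_1-X_2)^2+(X_1'-X_2')^2+(X_1-X_2)(X_1'-X_2')}{2X_{d,j}^2(\omega)}\right], $$ where $\approx$ means that the supremum of the modulus of the difference of the two sides over all $X_1,X_2,X_1',X_2'\in\mathbb{R}$ with $|X_1'-X_2'|\le\delta\ell$, in the limit superior $Z\to\infty$, tends to $0$ as $\delta\to0$.
   Context: Parameters: depth $\mathcal{D}>0$, wave speed $c_o>0$, wavenumber $k=\omega/c_o$, central frequency $\omega_0$. The number of propagating modes is $N=\lfloor k\mathcal{D}/\pi+1/2\rfloor$, assumed constant for $\omega\in[\omega_0-B/2,\omega_0+B/2]$, with $k\mathcal{D}/\pi=N+\alpha(\omega)-\tfrac12$ and $\alpha(\omega)\in(0,1)$. For $j=1,\ldots,N$, $$\beta_j(\omega)=\frac{\pi}{\mathcal{D}}\sqrt{\Big(\frac{k\mathcal{D}}{\pi}\Big)^2-\Big(j-\frac12\Big)^2}>0,\qquad q_{jj}=-2\Big(\frac{\pi}{\mathcal{D}}\Big)^2\Big(j-\frac12\Big)^2,\qquad \mathcal{S}_j(\omega)=\frac{8\beta_j^2(\omega)}{q_{jj}^2R_o(0)}$$ ($\mathcal{S}_j$ is the scattering mean free path of mode $j$; it decreases with $j$. $X_{d,j}$ is the decoherence length of mode $j$.) $R_o(\xi)=\int_{-\infty}^\infty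 R(\xi,\zeta)\,d\zeta$, where $R(\xi,\zeta)=\mathbb{E}[\mu(\xi'+\xi,\zeta'+\zeta)\mu(\xi',\zeta')]$ is the (integrable) covariance of a bounded, real, zero-mean, stationary, mixing random process $\mu$ on $\mathbb{R}^2$ that is twice differentiable with almost surely bounded derivatives. $R_o$ is four times differentiable, $R_o(0)>0$ is its maximum so that $R_o'(0)=0$, and the correlation length $\ell>0$ is defined by $R_o''(0)/R_o(0)=-1/\ell^2$. The transfer coefficients $\mathcal{T}_j(\omega,X,X',Z)$ are the (random) solutions of the It\^o-Schr\''odinger equations $$ d\mathcal{T}_j=\left[\frac{i}{2\beta_j(\omega)}\partial_X^2-\frac{q_{jj}^2R_o(0)}{8\beta_j^2(\omega)}\right]\mathcal{T}_j\,dZ+\frac{i\,q_{jj}}{2\beta_j(\omega)}\mathcal{T}_j\,d\mathcal{B}(X,Z),\quad Z>0,\qquad \mathcal{T}_j(\omega,X,X',0)=\delta(X-X'), $$ driven by a Brownian field $\mathcal{B}$ (real, Gaussian) with $\mathbb{E}[\mathcal{B}(X,Z)]=0$ and $\mathbb{E}[\mathcal{B}(X,Z)\mathcal{B}(X',Z')]=\min\{Z,Z'\}R_o(X-X')$. The second moment is identified with its kernel, the function $$ \mathbb{E}\left[\mathcal{T}_j(\omega,X_1,X_1',Z)\overline{\mathcal{T}_j(\omega,X_2,X_2',Z)}\right]=\frac{\beta_j}{2\pi Z}\exp\left\{\frac{i\beta_j[(X_1-X_1')^2-(X_2-X_2')^2]}{2Z}-\frac{2Z}{\mathcal{S}_j}\int_0^1C_o\big[(X_1-X_2)s+(X_1'-X_2')(1-s)\big]ds\right\},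 $$ where $C_o(X)=1-R_o(X)/R_o(0)$. *)

(* Defs.v *)
From HB Require Import structures.
From mathcomp Require Import all_boot all_order all_algebra.
From mathcomp Require Export complex.
From mathcomp Require Import all_classical all_reals all_analysis.

Set Implicit Arguments.
Unset Strict Implicit.
Unset Printing Implicit Defensive.

Import Order.TTheory GRing.Theory Num.Theory.
Import numFieldNormedType.Exports.

Local Open Scope classical_set_scope.
Local Open Scope ring_scope.
Local Open Scope complex_scope.

Section ComplexValues.
Context {R : realType}.

Definition expc (z : R[i]) : R[i] :=
  (expR (complex.Re z))%:C * (cos (complex.Im z) +i* sin (complex.Im z)).

Definition Cintegral {d} {T : measurableType d} (m : {measure set T -> \bar R})
    (A : set T) (f : T -> R[i]) : R[i] :=
  (\int[m]_(x in A) complex.Re (f x)) +i* (\int[m]_(x in A) complex.Im (f x)).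

Definition Cexpectation {d} {T : measurableType d} (P : probability T R)
    (f : T -> R[i]) : R[i] := Cintegral P setT f.

(* E|f|^2, possibly +oo *)
Definition mean_square {d} {T : measurableType d} (P : probability T R)
    (f : T -> R[i]) : \bar R := 'E_P[fun w => (Normc.normc (f w) ^+ 2)%R]%E.

End ComplexValues.

Section RandomMedium.
Context {R : realType} {d : measure_display} {Om : measurableType d}.
Variables (P : probability Om R) (mu : R * R -> Om -> R).

(* Events of the cylinder sigma-algebra on the space of sample paths. *)
Definition path_event : set (set (R * R -> R)) :=
  <<s [set A | exists x : R * R, exists2 U : set R,
         measurable U & A = [set f | U (f x)]] >>.

Definition twice_differentiable_bounded (f : R * R -> R) : Prop :=
  [/\ forall x, differentiable f x,
      forall v x, differentiable (fun y => 'D_v f y) x,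
      forall v, exists C, forall x, `|'D_v f x| <= C
    & forall v v', exists C, forall x,
        `|'D_v' (fun y => 'D_v f y) x| <= C].

(* By stationarity the base point (xi', zeta') may be taken to be the origin. *)
Definition covariance_fun (xi zeta : R) : R :=
  fine 'E_P[fun w => (mu (xi, zeta) w * mu (0, 0) w)%R]%E.

Definition integrated_covariance (xi : R) : R :=
  \int[lebesgue_measure]_zeta covariance_fun xi zeta.

Record random_medium : Prop := RandomMedium {
  medium_measurable : forall x, measurable_fun setT (mu x) ;
  medium_bounded : exists C : R, \forall w \ae P, forall x, `|mu x w| <= C ;
  medium_centered : forall x, ('E_P[mu x] = 0)%E ;
  medium_stationary : forall A (h : R * R), path_event A ->
    P [set w | A (fun x => mu (x + h) w)] = P [set w | A (mu^~ w)] ;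
  medium_mixing : forall A A', path_event A -> path_event A' ->
    forall e : R, 0 < e -> exists r, forall h : R * R, r <= `|h| ->
      `| fine (P [set w | A (mu^~ w) /\ A' (fun x => mu (x + h) w)])
         - fine (P [set w | A (mu^~ w)]) * fine (P [set w | A' (mu^~ w)]) | <= e ;
  medium_smooth : \forall w \ae P, twice_differentiable_bounded (mu^~ w) ;
  covariance_integrable :
    (lebesgue_measure \x lebesgue_measure)%E.-integrable setT
      (fun p : R * R => (covariance_fun p.1 p.2)%:E) ;
  (* the integral defining R_o(xi) converges for every xi, not only almost
     every one *)
  covariance_slice_integrable : forall xi,
    lebesgue_measure.-integrable setT
      (fun zeta : R => (covariance_fun xi zeta)%:E)
}.

End RandomMedium.

Section Waveguide.
Context {R : realType}.
(* depth and wave speed *)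
Variables (D co : R).

Definition wavenumber (w : R) : R := w / co.

Definition beta (j : nat) (w : R) : R :=
  pi / D * Num.sqrt ((wavenumber w * D / pi) ^+ 2 - (j%:R - 2^-1) ^+ 2).

Definition q (j : nat) : R := - 2 * (pi / D) ^+ 2 * (j%:R - 2^-1) ^+ 2.

(* Ro0 stands for R_o(0). *)
Definition mean_free_path (Ro0 : R) (j : nat) (w : R) : R :=
  8 * beta j w ^+ 2 / (q j ^+ 2 * Ro0).

Definition decoherence_length (ell Ro0 : R) (j : nat) (w Z : R) : R :=
  ell * Num.sqrt (3 * mean_free_path Ro0 j w / (2 * Z)).

Definition band (w0 Bw : R) : set R := `[w0 - Bw / 2, w0 + Bw / 2].

Record propagating_modes (w0 Bw : R) (N : nat) (alpha : R -> R) : Prop :=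
  PropagatingModes {
    mode_count : forall w, band w0 Bw w ->
      Num.floor (wavenumber w * D / pi + 2^-1) = N%:Z ;
    mode_alpha : forall w, band w0 Bw w ->
      wavenumber w * D / pi = N%:R + alpha w - 2^-1 ;
    mode_alpha_itv : forall w, band w0 Bw w -> 0 < alpha w < 1
  }.

End Waveguide.

Section BrownianField.
Context {R : realType} {d : measure_display} {Om : measurableType d}.
Variable P : probability Om R.

(* normal_prob m s is only the Gaussian law for s != 0, hence the separate
   degenerate case *)
Definition gaussian (Y : Om -> R) : Prop :=
  exists m s : R, forall U : set R, measurable U ->
    P (Y @^-1` U) = if s == 0 then \d_m U else normal_prob m s U.

(* W X Z is defined for all real Z, but only its values for Z >= 0 matter. *)
Record brownian_field (Ro : R -> R) (W : R -> R -> Om -> R) : Prop :=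
  BrownianField {
    brownian_measurable :
      measurable_fun setT (fun p : (R * R) * Om => W p.1.1 p.1.2 p.2) ;
    brownian_gaussian : forall n (a X Z : 'I_n -> R), (forall i, 0 <= Z i) ->
      gaussian (fun w => \sum_(i < n) a i * W (X i) (Z i) w) ;
    brownian_mean : forall X Z, 0 <= Z -> ('E_P[W X Z] = 0)%E ;
    brownian_covariance : forall X X' Z Z', 0 <= Z -> 0 <= Z' ->
      'E_P[fun w => (W X Z w * W X' Z' w)%R]%E
      = (Num.min Z Z' * Ro (X - X'))%:E
  }.

Record brownian_filtration (W : R -> R -> Om -> R) (F : R -> set (set Om)) :
    Prop := BrownianFiltration {
  filtration_sigma : forall Z, sigma_algebra setT (F Z) ;
  filtration_sub : forall Z, F Z `<=` measurable ;
  filtration_mono : forall Z Z', Z <= Z' -> F Z `<=` F Z' ;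
  filtration_adapted : forall X Z (U : set R), 0 <= Z -> measurable U ->
    F Z (W X Z @^-1` U) ;
  filtration_increments : forall Z A n (X Z' : 'I_n -> R) (U : 'I_n -> set R),
    0 <= Z -> F Z A -> (forall i, Z <= Z' i) -> (forall i, measurable (U i)) ->
    let incr := [set w | forall i, U i (W (X i) (Z' i) w - W (X i) Z w)] in
    P (A `&` incr) = (P A * P incr)%E
}.

End BrownianField.

Section ItoSchrodinger.
Context {R : realType} {d : measure_display} {Om : measurableType d}.
Variables (P : probability Om R) (W : R -> R -> Om -> R)
  (F : R -> set (set Om)).

Definition test_function (phi : R -> R) : Prop :=
  (forall n x, derivable (derive1n n phi) x 1) /\
  (exists r, forall x, r < `|x| -> phi x = 0).

Definition pairing (u : R -> R[i]) (phi : R -> R) : R[i] :=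
  Cintegral lebesgue_measure setT (fun X => u X * (phi X)%:C).

(* Left-endpoint sum over n.+1 equal subintervals of [a, b] for
   int_a^b int u(X, z) dX dW(X, z). *)
Definition ito_sum (u : R -> R -> Om -> R[i]) (a b : R) (n : nat) (w : Om) :
    R[i] :=
  let z k := a + (b - a) * k%:R / n.+1%:R in
  \sum_(k < n.+1) Cintegral lebesgue_measure setT (fun X =>
    u X (z k) w * (W X (z k.+1) w - W X (z k) w)%:C).

(* I is the Ito integral of u over [a, b]. For the adapted, mean-square
   continuous integrands to which this is applied, the Ito integral is the
   mean-square limit of the left-endpoint sums. *)
Definition is_ito_integral (u : R -> R -> Om -> R[i]) (a b : R)
    (I : Om -> R[i]) : Prop :=
  mean_square P (fun w => ito_sum u a b n w - I w) @[n --> \oo] --> 0%E.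

(* T X X' Z is the random field T_j(omega, X, X', Z), b = beta_j(omega),
   q = q_jj, Ro0 = R_o(0). The equation is tested in X against smooth compactly
   supported functions; the initial datum delta(X - X') is attained in mean
   square. *)
Record ito_schrodinger (b q Ro0 : R) (T : R -> R -> R -> Om -> R[i]) : Prop :=
  ItoSchrodinger {
    ito_measurable_re : forall X', measurable_fun setT
      (fun p : (R * R) * Om => complex.Re (T p.1.1 X' p.1.2 p.2)) ;
    ito_measurable_im : forall X', measurable_fun setT
      (fun p : (R * R) * Om => complex.Im (T p.1.1 X' p.1.2 p.2)) ;
    ito_adapted : forall X X' Z (U : set R), 0 < Z -> measurable U ->
      F Z [set w | U (complex.Re (T X X' Z w))] /\
      F Z [set w | U (complex.Im (T X X' Z w))] ;
    ito_square_integrable : forall X X' Z, 0 < Z ->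
      (mean_square P (T X X' Z) < +oo)%E ;
    ito_mean_square_continuous : forall X X' Z0, 0 < Z0 ->
      mean_square P (fun w => T X X' Z w - T X X' Z0 w) @[Z --> Z0] --> 0%E ;
    ito_equation : forall X' phi Z0 Z, test_function phi -> 0 < Z0 -> Z0 < Z ->
      is_ito_integral
        (fun X z w => (0 +i* (q / (2 * b))) * T X X' z w * (phi X)%:C)
        Z0 Z
        (fun w =>
           pairing (fun X => T X X' Z w) phi
           - pairing (fun X => T X X' Z0 w) phi
           - Cintegral lebesgue_measure `[Z0, Z] (fun z =>
               (0 +i* (2 * b)^-1)
                 * pairing (fun X => T X X' z w) (derive1n 2%N phi)
               - (q ^+ 2 * Ro0 / (8 * b ^+ 2))%:C
                 * pairing (fun X => T X X' z w) phi)) ;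
    ito_initial : forall X' phi, test_function phi ->
      mean_square P (fun w => pairing (fun X => T X X' Z w) phi - (phi X')%:C)
        @[Z --> 0^'+] --> 0%E
  }.

Definition second_moment (T : R -> R -> R -> Om -> R[i])
    (X1 X1' X2 X2' Z : R) : R[i] :=
  Cexpectation P (fun w => T X1 X1' Z w * conjc (T X2 X2' Z w)).

(* E_j(X1, X1', X2, X2'; Z), with b = beta_j(omega) *)
Definition scaled_moment (b : R) (T : R -> R -> R -> Om -> R[i])
    (X1 X1' X2 X2' Z : R) : R[i] :=
  (2 * pi * Z / b)%:C * second_moment T X1 X1' X2 X2' Z.

End ItoSchrodinger.

Section MomentFormula.
Context {R : realType}.

Definition Co (Ro : R -> R) (X : R) : R := 1 - Ro X / Ro 0.

Definition phase (b X1 X1' X2 X2' Z : R) : R :=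
  b * ((X1 - X1') ^+ 2 - (X2 - X2') ^+ 2) / (2 * Z).

(* b = beta_j(omega), S = S_j(omega) *)
Definition moment_kernel (Ro : R -> R) (b S X1 X1' X2 X2' Z : R) : R[i] :=
  (b / (2 * pi * Z))%:C *
  expc (- (2 * Z / S * \int[lebesgue_measure]_(s in `[0, 1])
              Co Ro ((X1 - X2) * s + (X1' - X2') * (1 - s)))
        +i* phase b X1 X1' X2 X2' Z).

Record correlation (Ro : R -> R) (ell : R) : Prop := Correlation {
  correlation_smooth : forall n x, (n < 4)%N -> derivable (derive1n n Ro) x 1 ;
  correlation_pos : 0 < Ro 0 ;
  correlation_max : forall x, Ro x <= Ro 0 ;
  correlation_length_pos : 0 < ell ;
  correlation_length : derive1n 2%N Ro 0 / Ro 0 = - (ell ^+ 2)^-1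
}.

End MomentFormula.

(* Main.v *)
(** Put [x = X1 - X2] and [y = X1' - X2']. For [Z > 0] the scaled moment and its
    approximation share their phase, and their moduli are [exp (- l J(x, y))] and
    [exp (- l Q(x, y))], with [l = 2 Z / S], [J(x, y)] the mean of [Co] over the
    segment from [y] to [x], and [Q(x, y) = (x^2 + y^2 + x y) / (6 ell^2)], the
    same mean for the parabola [u^2 / (2 ell^2)] osculating [Co] at 0.
    If [x] and [y] are small, then [|J - Q| <= eps Q], so that the two
    exponentials differ by [O (eps t exp (- t))] with [t = l Q / 2], uniformly in
    [l]. If [x] is not small while [y] is, then [J] is bounded below by a positive
    constant (by Fubini, [R_o] is integrable, so that [Co] has mean 1 at
    infinity), and both exponentials vanish as [l] tends to infinity.
    This is (ii); the case [y = 0] is (i). *)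

Require Import Defs.
From mathcomp Require Import all_boot all_order all_algebra.
From mathcomp Require Import all_classical all_reals all_analysis.
From mathcomp Require Import ring lra.

Import Order.TTheory GRing.Theory Num.Theory.
Import numFieldNormedType.Exports.

Local Open Scope classical_set_scope.
Local Open Scope ring_scope.
Local Open Scope complex_scope.

(** * Calculus on the line: primitives and means over segments *)

Section Calculus.
Set Implicit Arguments.
Unset Strict Implicit.
Context {R : realType}.
Implicit Types (f df Phi : R -> R).

Lemma is_derive_continuous f df :
  (forall x : R, is_derive x 1 f (df x)) -> continuous f.
Proof.
by move=> fdf x; apply/differentiable_continuous/derivable1_diffP/ex_derive.
Qed.

Lemma derive_ge0_le f df a b : (forall x : R, is_derive x 1 f (df x)) ->
  a <= b -> (forall x, a <= x <= b -> 0 <= df x) -> f a <= f b.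
Proof.
move=> fdf ab df0.
have [|c] := MVT_segment ab (fun x _ => fdf x).
  exact/continuous_subspaceT/(is_derive_continuous fdf).
rewrite in_itv/= => /df0 dfc0 fE.
by rewrite -subr_ge0 fE mulr_ge0// subr_ge0.
Qed.

(** Substitution [s |-> x s + y (1 - s)] and the fundamental theorem of calculus. The factor [x - y]
    stays on the left, so that no order of [x] and [y], nor [x != y], is assumed. *)
Lemma integral_segment f Phi x y : continuous f ->
  (forall u : R, is_derive u 1 Phi (f u)) ->
  (x - y) * \int[lebesgue_measure]_(s in `[0, 1]) f (x * s + y * (1 - s))
  = Phi x - Phi y.
Proof.
move=> fc Phif.
pose g s := x * s + y * (1 - s).
have gd (s : R) : is_derive s 1 g (x - y).
  by apply: is_derive_eq; rewrite /GRing.scale/=; ring.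
pose G s := Phi (g s).
have Gd (s : R) : is_derive s 1 G (f (g s) * (x - y)).
  exact: (@is_derive1_comp _ Phi g).
have Gc : continuous G by exact: is_derive_continuous Gd.
have hc : continuous (fun s => f (g s) * (x - y)).
  move=> s; apply: cvgM; last exact: cvg_cst.
  by apply: continuous_comp; [exact: is_derive_continuous gd _ | exact: fc].
have := @continuous_FTC2 R (fun s => f (g s) * (x - y)) G 0 1 ltr01.
have -> : G 0 = Phi y by rewrite /G /g mulr0 subr0 mulr1 add0r.
have -> : G 1 = Phi x by rewrite /G /g mulr1 subrr mulr0 addr0.
move=> FTC.
rewrite -[RHS]/(fine (Phi x - Phi y)%:E) EFinB -FTC; last first.
- by move=> s _; rewrite derive1E; apply: derive_val.
- split.
  + by move=> s _; apply: ex_derive.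
  + by apply: cvg_at_right_filter; exact: Gc.
  + by apply: cvg_at_left_filter; exact: Gc.
- exact: continuous_subspaceT.
rewrite -/(Rintegral _ _ _) RintegralZr//; first by rewrite mulrC.
apply: continuous_compact_integrable; first exact: segment_compact.
apply: continuous_subspaceT => s.
by apply: continuous_comp; [exact: is_derive_continuous gd _ | exact: fc].
Qed.

(** Covers the degenerate segment, on which [integral_segment] only says [0 = 0]. *)
Lemma integral_segment_diag f x :
  \int[lebesgue_measure]_(s in `[0, 1]) f (x * s + x * (1 - s)) = f x.
Proof.
under eq_Rintegral do rewrite -mulrDr addrC subrK mulr1.
rewrite Rintegral_cst//= lebesgue_measure_itv/= lte_fin ltr01 oppr0 adde0.
by rewrite mulr1.
Qed.

(** The primitive is the integral from minus infinity, bounded by the L1 norm of [f]. *)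
Lemma bounded_primitive f : continuous f ->
  lebesgue_measure.-integrable setT (EFin \o f) ->
  exists Phi K, (forall u : R, is_derive u 1 Phi (f u)) /\ forall u, `|Phi u| <= K.
Proof.
move=> fc fi.
pose Phi u := \int[lebesgue_measure]_(t in `]-oo, u]) f t.
exists Phi, (\int[lebesgue_measure]_t `|f t|); split.
  move=> u.
  (* Integrating up to [u + 1] makes [u] an interior point, where the fundamental theorem gives a
     two-sided derivative. *)
  have uu1 : u < u + 1 by rewrite ltrDl.
  have fiu : lebesgue_measure.-integrable `]-oo, u + 1] (EFin \o f).
    by apply: integrableS fi => //; exact: subsetT.
  have [|dPhi PhiE] := continuous_FTC1 uu1 fiu _ (fc u); first by rewrite ltNyr.
  by apply: DeriveDef => //; rewrite -derive1E.
move=> u; rewrite (le_trans (le_normr_Rintegral _ _))//.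
  by apply: integrableS fi => //; exact: subsetT.
have absi : lebesgue_measure.-integrable setT (EFin \o (fun t => `|f t|)).
  by rewrite (_ : _ \o _ = abse \o (EFin \o f))//; exact: integrable_abse.
rewrite fine_le//.
- by apply: integrable_fin_num => //; apply: integrableS absi => //; exact: subsetT.
- exact: integrable_fin_num.
by apply: ge0_subset_integral => //; case/integrableP : absi.
Qed.

End Calculus.

(** * The correlation function: behaviour at 0 and means of [Co] *)

Section Correlation.
Set Implicit Arguments.
Unset Strict Implicit.
Context {R : realType}.

(** Fubini. Integrability of every slice makes the inner integral finite for each [xi], so that it
    agrees with its real-valued version. *)
Lemma integrated_covariance_integrable {d : measure_display}
    {Om : measurableType d} (P : probability Om R) (mu : R * R -> Om -> R) :
  random_medium P mu ->
  lebesgue_measure.-integrable setT (EFin \o integrated_covariance P mu).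
Proof.
move=> H.
have := integrable_fubini_F (covariance_integrable H).
apply: eq_integrable => // xi _.
rewrite /fubini_F/= /integrated_covariance /Rintegral fineK//.
exact: integrable_fin_num (covariance_slice_integrable H xi).
Qed.

Variables (Ro : R -> R) (ell : R).
Hypothesis HRo : correlation Ro ell.

Let Ro_pos : 0 < Ro 0 := correlation_pos HRo.
Let ell_pos : 0 < ell := correlation_length_pos HRo.

Lemma correlation_derive n x : (n < 4)%N ->
  is_derive (x : R) (1 : R) (derive1n n Ro) (derive1n n.+1 Ro x).
Proof.
move=> n4; apply: DeriveDef; first exact: (correlation_smooth HRo).
by rewrite derive1nS -derive1E.
Qed.

Lemma correlation_continuous : continuous Ro.
Proof. exact: is_derive_continuous (fun x => @correlation_derive 0 x isT). Qed.

(** The origin is an interior maximum. *)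
Lemma correlation_derive0 : derive1 Ro 0 = 0.
Proof.
suff [_ Ro0] : is_derive (0 : R) (1 : R) Ro 0 by rewrite derive1E.
apply: (@derive1_at_max _ Ro (-1) 1 0); first lra.
- by move=> t _; exact: (@correlation_smooth _ _ _ HRo 0%N).
- by rewrite in_itv/=; lra.
- by move=> t _; exact: correlation_max HRo t.
Qed.

Lemma Co_ge0 x : 0 <= Co Ro x.
Proof. by rewrite subr_ge0 ler_pdivrMr// mul1r (correlation_max HRo). Qed.

Lemma Co0 : Co Ro 0 = 0.
Proof. by rewrite /Co divff ?subrr// gt_eqF. Qed.

Lemma Co_derive x : is_derive (x : R) (1 : R) (Co Ro) (- derive1 Ro x / Ro 0).
Proof.
have := @correlation_derive 0 x isT; rewrite derive1n0 derive1n1 => Rod.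
rewrite /Co.
by apply: is_derive_eq; rewrite /GRing.scale/=; ring.
Qed.

Lemma Co_continuous : continuous (Co Ro).
Proof. exact: is_derive_continuous Co_derive. Qed.

(** First-order expansion of the derivative of [Ro] at 0, where the derivative vanishes and has
    slope [- Ro 0 / ell^2]. *)
Lemma Co_derive_approx (e : R) : 0 < e -> exists2 r : R, 0 < r &
  forall x : R, `|x| <= r -> `|- derive1 Ro x / Ro 0 - x / ell ^+ 2| <= e * `|x|.
Proof.
move=> e0.
(* The remainder of the expansion is [- Ro 0] times the quantity to be bounded, hence the scaled
   tolerance. *)
have eRo0 : 0 < e * Ro 0 by rewrite mulr_gt0.
have := @correlation_derive 1 0 isT.
rewrite derive1n1 => -[dRo R2].
have RoE : derive1n 2 Ro 0 = - (Ro 0 / ell ^+ 2).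
  have := correlation_length HRo => /(canRL (divfK _)) ->; last by rewrite gt_eqF.
  by rewrite mulNr mulrC.
have /eqaddoP/(_ _ eRo0) := derivable_nbhs dRo.
move=> /nbhs_ballP[r /= r0 rP].
(* Halving the radius puts the closed ball inside the open one. *)
exists (r / 2) => [|x xr]; first by rewrite divr_gt0.
have := rP x; rewrite /ball/= sub0r normrN => /(_ _)/wrap[].
  by rewrite (le_lt_trans xr)// ltr_pdivrMr// ltr_pMr// ltr1n.
rewrite !fctE/= /GRing.scale/= mulr1 addr0 R2 RoE correlation_derive0 add0r.
have Rn : Ro 0 != 0 by rewrite gt_eqF.
have elln : ell != 0 by rewrite gt_eqF.
rewrite (_ : _ - _ = - Ro 0 * (- derive1 Ro x / Ro 0 - x / ell ^+ 2)); last first.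
  by field; rewrite elln.
rewrite normrM normrN (gtr0_norm Ro_pos) [X in X * `|x|]mulrC -mulrA.
by rewrite ler_pM2l.
Qed.

(** Mean value theorem for the difference [g], which vanishes at 0 and whose derivative is at most
    [e |x|] between 0 and [x]. *)
Lemma Co_approx (e : R) : 0 < e -> exists2 r : R, 0 < r &
  forall x : R, `|x| <= r -> `|Co Ro x - x ^+ 2 / (2 * ell ^+ 2)| <= e * x ^+ 2.
Proof.
move=> e0; have [r r0 rP] := Co_derive_approx e0.
exists r => // x xr.
pose g u := Co Ro u - u ^+ 2 / (2 * ell ^+ 2).
have elln : ell != 0 by rewrite gt_eqF.
have gd (u : R) : is_derive u (1 : R) g (- derive1 Ro u / Ro 0 - u / ell ^+ 2).
  have Cd := Co_derive u.
  by apply: is_derive_eq; rewrite /GRing.scale/=; field; rewrite elln gt_eqF.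
have g0 : g 0 = 0 by rewrite /g Co0 expr0n/= mul0r subrr.
have gc : continuous g := is_derive_continuous gd.
have bound u : `|u| <= `|x| ->
    `|(- derive1 Ro u / Ro 0 - u / ell ^+ 2)| <= e * `|x|.
  move=> ux; rewrite (le_trans (rP _ (le_trans ux xr)))// ler_pM2l//.
rewrite -/(g x) -[g x]subr0 -g0 -[x ^+ 2]real_normK ?num_real//.
have [x0|x0] := leP 0 x.
  have [|c] := MVT_segment x0 (fun u _ => gd u); first exact: continuous_subspaceT.
  rewrite in_itv/= => /andP[c0 cx] ->; rewrite subr0 normrM expr2 mulrA.
  by rewrite ler_wpM2r// bound// !ger0_norm//.
have [|c] := MVT_segment (ltW x0) (fun u _ => gd u); first exact: continuous_subspaceT.
rewrite in_itv/= => /andP[c0 cx]; rewrite distrC => ->.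
rewrite sub0r normrM normrN expr2 mulrA.
by rewrite ler_wpM2r// bound// !ler0_norm ?lerN2// ltW.
Qed.

Hypothesis Roi : lebesgue_measure.-integrable setT (EFin \o Ro).

(** [Co] is 1 minus an integrable function, so its primitive stays at bounded distance from the
    identity. This controls means over long segments. *)
Lemma Co_primitive : exists (Psi : R -> R) (K : R),
  (forall u : R, is_derive u (1 : R) Psi (Co Ro u)) /\ forall u, `|Psi u - u| <= K.
Proof.
have [Phi [K [Phid PhiK]]] := bounded_primitive correlation_continuous Roi.
exists (fun u => u - Phi u / Ro 0), (K / Ro 0); split=> u.
  by rewrite /Co; apply: is_derive_eq; rewrite /GRing.scale/=; ring.
by rewrite addrAC subrr sub0r normrN normrM normfV (gtr0_norm Ro_pos) ler_pM2r// invr_gt0.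
Qed.

Definition Co_mean x y :=
  \int[lebesgue_measure]_(s in `[0, 1]) Co Ro (x * s + y * (1 - s)).

Let qf x y : R := x ^+ 2 + y ^+ 2 + x * y.

(* [Psi] below is a primitive of [Co Ro]: the functions
   [e u^3 +- (Psi u - u^3/(6 ell^2))] are nondecreasing near 0, and
   [x^3 - y^3 = (x - y) (x^2 + y^2 + x y)]. *)
Lemma Co_mean_approx (e : R) : 0 < e -> exists2 r : R, 0 < r &
  forall x y : R, `|x| <= r -> `|y| <= r ->
    `|Co_mean x y - qf x y / (6 * ell ^+ 2)| <= e * qf x y.
Proof.
(* The cubic [e u^3] has derivative [3 e u^2], which has to dominate the error in [Co_approx]. *)
move=> e0; have e30 : 0 < 3 * e by rewrite mulr_gt0.
have [Psi [_ [Psid _]]] := Co_primitive.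
have [r r0 rP] := Co_approx e30; exists r => // x y.
have elln : ell != 0 by rewrite gt_eqF.
have mono (t a b : R) : `|t| <= 1 -> - r <= a -> a <= b -> b <= r ->
    0 <= e * (b ^+ 3 - a ^+ 3)
         + t * (Psi b - Psi a - (b ^+ 3 - a ^+ 3) / (6 * ell ^+ 2)).
  move=> t1 ra ab br.
  pose G u := e * u ^+ 3 + t * (Psi u - u ^+ 3 / (6 * ell ^+ 2)).
  have Gd (u : R) : is_derive u (1 : R) G
      (3 * e * u ^+ 2 + t * (Co Ro u - u ^+ 2 / (2 * ell ^+ 2))).
    by apply: is_derive_eq; rewrite /GRing.scale/=; field.
  have : G a <= G b.
    apply: (derive_ge0_le Gd ab) => u /andP[au ub].
    have /rP ur : `|u| <= r by rewrite ler_norml; apply/andP; split; lra.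
    have : `|t * (Co Ro u - u ^+ 2 / (2 * ell ^+ 2))| <= 3 * e * u ^+ 2.
      by rewrite normrM (le_trans _ ur)// ler_piMl.
    rewrite ler_norml => /andP[]; lra.
  by rewrite -subr_ge0 /G; congr (is_true (0 <= _)); ring.
have bd a b : - r <= a -> a <= b -> b <= r ->
    `|Psi b - Psi a - (b ^+ 3 - a ^+ 3) / (6 * ell ^+ 2)| <= e * (b ^+ 3 - a ^+ 3).
  move=> ra ab br; rewrite ler_norml.
  have := mono 1 a b; have := mono (-1) a b.
  rewrite normrN normr1 => /(_ (lexx _) ra ab br) m1 /(_ (lexx _) ra ab br) m2.
  by apply/andP; split; lra.
rewrite !ler_norml => /andP[rx xr] /andP[ry yr]; rewrite -ler_norml.
have JE := integral_segment x y Co_continuous Psid.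
rewrite -/(Co_mean x y) in JE.
have xy3 : x ^+ 3 - y ^+ 3 = (x - y) * qf x y by rewrite /qf; ring.
have scale (t j q c : R) : 0 < t -> `|t * j - t * q / c| <= e * (t * q) ->
    `|j - q / c| <= e * q.
  by move=> t0; rewrite -mulrA -mulrBr mulrCA normrM gtr0_norm// ler_pM2l.
(* Off the diagonal the estimate is divided by [|x - y|]; on it, the mean is the value of [Co] and
   [qf x x = 3 x^2], so that [Co_approx] applies directly. *)
have [xy|yx|xy] := ltgtP x y.
- have := bd x y rx (ltW xy) yr.
  rewrite (_ : Psi y - Psi x = (y - x) * Co_mean x y); last lra.
  rewrite (_ : y ^+ 3 - x ^+ 3 = (y - x) * qf x y); last lra.
  by apply: scale; rewrite subr_gt0.
- have := bd y x ry (ltW yx) xr.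
  by rewrite -JE xy3; apply: scale; rewrite subr_gt0.
- rewrite -xy /Co_mean integral_segment_diag.
  have -> : qf x x = 3 * x ^+ 2 by rewrite /qf; ring.
  have -> : e * (3 * x ^+ 2) = 3 * e * x ^+ 2 by ring.
  have -> : 3 * x ^+ 2 / (6 * ell ^+ 2) = x ^+ 2 / (2 * ell ^+ 2) by field.
  by apply: rP; rewrite ler_norml rx.
Qed.

(* The mean over a long segment is close to 1 since [Ro] is integrable; over a
   segment of moderate length, [Co Ro] is positive near, but off, 0. *)
Lemma Co_mean_lower_bound : exists2 r0 : R, 0 < r0 &
  forall r : R, 0 < r <= r0 -> exists2 c : R, 0 < c &
    forall x y : R, r <= `|x| -> `|y| <= r / 2 -> c <= Co_mean x y.
Proof.
have elln : ell != 0 by rewrite gt_eqF.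
have ell2 : 0 < ell ^+ 2 by rewrite exprn_gt0.
(* Half the coefficient of the osculating parabola: within [r0] of 0 this leaves
   [Co u >= u^2 / (4 ell^2)], positive off 0. *)
have e0 : 0 < (4 * ell ^+ 2)^-1 :> R by rewrite invr_gt0 mulr_gt0.
have [r0 r00 r0P] := Co_approx e0; exists r0 => // r /andP[rgt0 rr0].
have [Psi [K [Psid PsiK]]] := Co_primitive.
have K0 : 0 <= K by exact: le_trans (PsiK 0).
have Psi_le a b : a <= b -> Psi a <= Psi b.
  by move=> ab; apply: (derive_ge0_le Psid ab) => u _; exact: Co_ge0.
have Psi_lt a b : a < b -> (forall u, a < u < b -> 0 < `|u| <= r) -> Psi a < Psi b.
  move=> ab abP; have [|c] := MVT ab (fun u _ => Psid u).
    exact/continuous_subspaceT/(is_derive_continuous Psid).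
  rewrite in_itv/= => /abP/andP[c0 cr] PsiE; rewrite -subr_gt0 PsiE.
  rewrite mulr_gt0//; last by rewrite subr_gt0.
  have := r0P c (le_trans cr rr0).
  rewrite ler_norml => /andP[+ _].
  have : 0 < c ^+ 2 / (4 * ell ^+ 2) 
    by rewrite -real_normK ?num_real// divr_gt0 ?exprn_gt0 ?mulr_gt0.
  have -> : c ^+ 2 / (2 * ell ^+ 2) = 2 * (c ^+ 2 / (4 * ell ^+ 2)) by field.
  by rewrite [_^-1 * _]mulrC; lra.
have m10 : Psi (r / 2) < Psi r.
  by apply: Psi_lt => [|u /andP[u1 u2]]; [lra|rewrite gtr0_norm; lra].
have m20 : Psi (- r) < Psi (- (r / 2)).
  by apply: Psi_lt => [|u /andP[u1 u2]]; [lra|rewrite ltr0_norm; lra].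
(* A segment from [y] to [x] with [|x| >= r] and [|y| <= r / 2] contains [[r / 2, r]] or
   [[- r, - (r / 2)]], so [Psi] grows along it by at least [m]. *)
pose m := Num.min (Psi r - Psi (r / 2)) (Psi (- (r / 2)) - Psi (- r)).
have m0 : 0 < m by rewrite lt_min !subr_gt0 m10 m20.
(* The increment [I] of [Psi] satisfies both [I >= m] and [I >= (b - a) - 2 K]; hence
   [m (b - a) <= m I + 2 K m <= (m + 2 K) I], whatever the length. *)
have bd a b : a < b -> m <= Psi b - Psi a ->
    m / (m + 2 * K) <= (Psi b - Psi a) / (b - a).
  move=> ab mle; have ba0 : 0 < b - a by rewrite subr_gt0.
  have mK : 0 < m + 2 * K by lra.
  rewrite ler_pdivrMr// mulrAC ler_pdivlMr//.
  have : b - a - 2 * K <= Psi b - Psi a.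
    by have := PsiK a; have := PsiK b; rewrite !ler_norml; lra.
  nra.
exists (m / (m + 2 * K)); first by rewrite divr_gt0//; lra.
move=> x y; have JE := integral_segment x y Co_continuous Psid.
rewrite -/(Co_mean x y) in JE.
move=> rx; rewrite ler_norml => /andP[y1 y2]; have [x0|x0] := leP 0 x.
  rewrite ger0_norm// in rx; have yx : y < x by lra.
  rewrite (_ : Co_mean x y = (Psi x - Psi y) / (x - y)).
    apply: bd => //; rewrite (@le_trans _ _ (Psi r - Psi (r / 2)))// ?ge_min ?lexx//.
    by apply: lerB; exact: Psi_le.
  by rewrite -JE mulrC mulKf// subr_eq0 gt_eqF.
rewrite ltr0_norm// in rx; have yx : x < y by lra.
rewrite (_ : Co_mean x y = (Psi y - Psi x) / (y - x)).
  apply: bd => //; rewrite (@le_trans _ _ (Psi (- (r / 2)) - Psi (- r)))//.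
    by rewrite ge_min lexx orbT.
  by apply: lerB; apply: Psi_le; lra.
by rewrite -opprB -JE -mulNr opprB mulrC mulKf// subr_eq0 gt_eqF.
Qed.

End Correlation.

(** * Uniform comparison of the two damping factors *)

Section MomentAsymptotics.
Set Implicit Arguments.
Unset Strict Implicit.
Context {R : realType}.

Lemma expRN_le_inv (t : R) : 0 < t -> expR (- t) <= t^-1.
Proof.
move=> t0; rewrite expRN lef_pV2 ?posrE ?expR_gt0//.
by rewrite (le_trans _ (expR_ge1Dx t))// lerDr.
Qed.

(** For [a <= b] the difference is [exp (- a) (1 - exp (a - b))], and [1 - exp (- s) <= s]. Keeping
    the factor [exp (- m)] lets it absorb a large [|a - b|]. *)
Lemma expRN_dist (m a b : R) : m <= a -> m <= b ->
  `|expR (- a) - expR (- b)| <= `|a - b| * expR (- m).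
Proof.
wlog ab : a b / a <= b.
  move=> wlg ma mb; have [/wlg|/ltW/wlg] := leP a b; first exact.
  by rewrite distrC [`|a - b|]distrC; exact.
move=> ma mb; rewrite ger0_norm ?subr_ge0 ?ler_expR ?lerN2//.
rewrite distrC ger0_norm ?subr_ge0//.
have -> : expR (- a) - expR (- b) = expR (- a) * (1 - expR (a - b)).
  by rewrite mulrBr mulr1 -expRD; congr (_ - expR _); ring.
rewrite mulrC ler_pM ?expR_ge0 ?ler_expR ?lerN2//.
  by rewrite subr_ge0 expR_le1 subr_le0.
by have := expR_ge1Dx (a - b); lra.
Qed.

Variables (Ro : R -> R) (ell : R).
Hypothesis HRo : correlation Ro ell.
Hypothesis Roi : lebesgue_measure.-integrable setT (EFin \o Ro).

(** Here [l] stands for [2 Z / S]. Both [r] and [L] are chosen before [x] and [y], as the suprema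
    over positions require. *)
Lemma damping_approx (e : R) : 0 < e -> exists2 r : R, 0 < r & exists L : R,
  forall l x y : R, L <= l -> `|y| <= r ->
    `|expR (- (l * Co_mean Ro x y))
      - expR (- (l * ((x ^+ 2 + y ^+ 2 + x * y) / (6 * ell ^+ 2))))| <= e.
Proof.
move=> e0; have ell0 := correlation_length_pos HRo.
pose k := (6 * ell ^+ 2)^-1.
have k0 : 0 < k by rewrite invr_gt0 mulr_gt0// exprn_gt0.
(* The bound [k / 2] keeps the mean of [Co] above [Q k / 2], so both exponents are at least [t]; the
   bound [e k / 2] makes their distance at most [e t]. *)
pose d := Num.min (e * k / 2) (k / 2).
have d0 : 0 < d by rewrite lt_min !divr_gt0 ?mulr_gt0.
have de : d <= e * k / 2 by rewrite ge_min lexx.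
have dk : d <= k / 2 by rewrite ge_min lexx orbT.
have [r1 r10 near0] := Co_mean_approx HRo Roi d0.
have [r2 r20 far] := Co_mean_lower_bound HRo Roi.
pose r := Num.min r1 r2.
have r0 : 0 < r by rewrite lt_min r10.
have [|c c0 farc] := far r; first by rewrite r0 ge_min lexx orbT.
pose c2 := Num.min c (k * (3 / 4 * r ^+ 2)).
have c20 : 0 < c2 by rewrite lt_min c0/= !mulr_gt0// exprn_gt0.
(* The lower bound for [|x| >= r] asks for [|y| <= r / 2]. *)
exists (r / 2); first by rewrite divr_gt0.
(* With this threshold, [exp (- l c2) <= 1 / (l c2) <= e]. *)
exists (c2 * e)^-1 => l x y Ll yr.
have l0 : 0 < l by rewrite (lt_le_trans _ Ll)// invr_gt0 mulr_gt0.
set Q := _ + x * y; rewrite -/k.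
(* Completing the square shows that [Q] is nonnegative and at least [3/4 x^2], whatever the sign of
   [x y]. *)
have QE : Q = 3 / 4 * x ^+ 2 + (x / 2 + y) ^+ 2 by rewrite /Q; field.
have Q0 : 0 <= Q by rewrite QE addr_ge0 ?sqr_ge0// mulr_ge0 ?sqr_ge0.
have [rx|xr] := leP r `|x|.
  have A : c2 <= Co_mean Ro x y by rewrite (le_trans _ (farc _ _ rx yr))// ge_min lexx.
  have B : c2 <= Q * k.
    rewrite ge_min; apply/orP; right; rewrite mulrC ler_pM2r// QE.
    rewrite (@le_trans _ _ (3 / 4 * x ^+ 2))//; last by rewrite lerDl sqr_ge0.
    have : r ^+ 2 <= x ^+ 2.
      by rewrite -[x ^+ 2]real_normK ?num_real// ler_pXn2r// nnegrE ltW.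
    lra.
  have lc2 : 0 < l * c2 by rewrite mulr_gt0.
  have small t : c2 <= t -> 0 <= expR (- (l * t)) <= e.
    move=> ct; rewrite expR_ge0/= (@le_trans _ _ (expR (- (l * c2))))//.
      by rewrite ler_expR lerN2 ler_pM2l.
    rewrite (le_trans (expRN_le_inv lc2))// invf_ple ?posrE// mulrC -ler_pdivrMl//.
    by rewrite -invfM.
  by rewrite ler_norml; have := small _ A; have := small _ B; lra.
have near : `|Co_mean Ro x y - Q * k| <= d * Q.
  apply: near0; first by rewrite (le_trans (ltW xr))// ge_min lexx.
  by rewrite (le_trans yr)// (@le_trans _ _ r)// ?ge_min ?lexx//; lra.
pose t := l * (Q * k / 2).
have t0 : 0 <= t by rewrite !mulr_ge0// ltW.
have dQ : d * Q <= k / 2 * Q by rewrite ler_wpM2r.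
have Qk0 : 0 <= Q * k by rewrite mulr_ge0// ltW.
apply: le_trans (@expRN_dist t _ _ _ _) _.
- by rewrite ler_pM2l//; move: near; rewrite ler_norml => /andP[]; lra.
- by rewrite ler_pM2l//; lra.
rewrite -mulrBr normrM gtr0_norm//.
apply: (@le_trans _ _ (e * t * expR (- t))).
  rewrite ler_wpM2r ?expR_ge0// /t mulrCA ler_pM2l// (le_trans near)//.
  by rewrite (le_trans (ler_wpM2r Q0 de))//; lra.
(* What remains is [t exp (- t) <= 1], from [1 + t <= exp t]. *)
rewrite -mulrA ler_piMr ?(ltW e0)//.
rewrite expRN ler_pdivrMr ?expR_gt0// mul1r.
by have := expR_ge1Dx t; lra.
Qed.

End MomentAsymptotics.

(** * Moduli of complex exponentials *)

Section ComplexExponential.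
Context {R : realType}.

Lemma normc_polar (x p : R) : Normc.normc (x%:C * (cos p +i* sin p)) = `|x|.
Proof.
rewrite Normc.normcM /Normc.normc/= expr0n/= addr0 sqrtr_sqr cos2Dsin2 sqrtr1.
by rewrite mulr1.
Qed.

Lemma normc_ge0 (z : R[i]) : 0 <= Normc.normc z.
Proof. by case: z => x y; rewrite sqrtr_ge0. Qed.

Lemma expcE (a p : R) : expc (a +i* p) = (expR a)%:C * (cos p +i* sin p).
Proof. by []. Qed.

Lemma normc_expc (a p : R) : Normc.normc (expc (a +i* p)) = expR a.
Proof. by rewrite expcE normc_polar ger0_norm ?expR_ge0. Qed.

(** The common phase factors out with modulus 1, which leaves real exponentials only. *)
Lemma normc_expcB (a a' p : R) :
  Normc.normc (expc (a +i* p) - expc (a' +i* p)) = `|expR a - expR a'|.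
Proof. by rewrite !expcE -mulrBl -rmorphB normc_polar. Qed.

End ComplexExponential.

(** * Limits of extended-real suprema, and limits in [Z] *)

Section Limits.
Context {R : realType}.

(** The bound with [e = 1] makes [f] eventually finite, after which convergence is that of real
    numbers. *)
Lemma cvge0_squeeze {T : Type} (F : set_system T) {FF : Filter F}
    (f : T -> \bar R) :
  (forall e : R, 0 < e -> \forall x \near F, (0 <= f x <= e%:E)%E) ->
  f x @[x --> F] --> 0%E.
Proof.
move=> fP; apply/fine_cvgP; split.
  apply: filterS (fP 1 ltr01) => x /andP[f0 f1].
  by rewrite ge0_fin_numE// (le_lt_trans f1) ?ltry.
apply/cvgrPdist_le => e e0; apply: filterS (fP e e0) => x /andP[f0 fe].
have ffin : f x \is a fin_num by rewrite ge0_fin_numE// (le_lt_trans fe) ?ltry.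
by rewrite sub0r normrN ger0_norm ?fine_ge0//= -lee_fin fineK.
Qed.

(** The limit superior is an infimum of suprema over the sets of the filter, and [f <= a] defines
    one of these sets. *)
Lemma limf_esup_le {T : choiceType} {X : filteredType T} (F : set_system X)
    (f : X -> \bar R) (a : \bar R) :
  (\forall x \near F, (f x <= a)%E) -> (limf_esup f F <= a)%E.
Proof.
move=> fa; rewrite limf_esupE; apply: ge_ereal_inf.
exists (ereal_sup (f @` [set x | (f x <= a)%E])); first by exists [set x | (f x <= a)%E].
by apply: ge_ereal_sup => _ [x /= fxa <-].
Qed.

Lemma ereal_sup_mem_ge0 (A : set (\bar R)) (x : R) :
  A x%:E -> 0 <= x -> (0 <= ereal_sup A)%E.
Proof. by move=> Ax x0; apply: le_ereal_sup_tmp; exists x%:E; rewrite ?lee_fin. Qed.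

Lemma sqrt_div_cvg0 (c : R) : 0 < c -> Num.sqrt (c / Z) @[Z --> +oo] --> (0 : R).
Proof.
move=> c0; apply/cvgrPdist_le => e e0; near=> Z.
have Z0 : 0 < Z by near: Z; exact/nbhs_pinfty_gt/num_real.
have : c / e ^+ 2 <= Z by near: Z; exact/nbhs_pinfty_ge/num_real.
rewrite ler_pdivrMr ?exprn_gt0// => cZ.
rewrite sub0r normrN ger0_norm ?sqrtr_ge0// -[leRHS](ger0_norm (ltW e0)).
by rewrite -sqrtr_sqr; apply: ler_wsqrtr; rewrite ler_pdivrMr// mulrC.
Unshelve. all: by end_near. Qed.

(** An arbitrary filter is allowed, so that the two limits are shown to describe the same regime. *)
Lemma cvgy_div (G : set_system R) {FG : Filter G} (c : R) : 0 < c ->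
  (Z / c @[Z --> G] --> +oo) <-> (Z @[Z --> G] --> +oo).
Proof.
move=> c0; rewrite !cvgryPge; split=> GP A.
  by apply: filterS (GP (A / c)) => Z; rewrite ler_pM2r ?invr_gt0.
by apply: filterS (GP (A * c)) => Z; rewrite ler_pdivlMr.
Qed.

End Limits.

(** * Positivity of the modal parameters *)

Section Modes.
Context {R : realType}.
Variables (D co : R).
Hypothesis D0 : 0 < D.

(** In the band [k D / pi = N + alpha - 1/2] with [alpha > 0], which exceeds [j - 1/2] for every
    [j <= N]. *)
Lemma beta_gt0 w0 Bw N alpha j w : propagating_modes D co w0 Bw N alpha ->
  band w0 Bw w -> (1 <= j <= N)%N -> 0 < beta D co j w.
Proof.
move=> [_ kE alpha01] ww /andP[j1 jN].
have /andP[a0 _] := alpha01 _ ww.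
rewrite /beta mulr_gt0 ?divr_gt0 ?pi_gt0// sqrtr_gt0 subr_gt0 kE//.
have : 1 <= j%:R :> R by rewrite ler1n.
have : j%:R <= N%:R :> R by rewrite ler_nat.
move=> jN' j1'; rewrite ltr_pXn2r ?nnegrE//; lra.
Qed.

Lemma mean_free_path_gt0 (Ro0 : R) j w : 0 < Ro0 -> (0 < j)%N ->
  0 < beta D co j w -> 0 < mean_free_path D co Ro0 j w.
Proof.
move=> Ro00 j0 b0.
have j1 : 1 <= j%:R :> R by rewrite ler1n.
have q0 : 0 < q D j ^+ 2.
  rewrite exprn_even_gt0//= /q mulf_neq0 ?expf_neq0//.
    by rewrite mulf_neq0 ?oppr_eq0 ?expf_neq0// gt_eqF ?divr_gt0 ?pi_gt0.
  by rewrite gt_eqF//; lra.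
by rewrite divr_gt0// mulr_gt0// exprn_gt0.
Qed.

Lemma decoherence_length_sqr (ell Ro0 : R) j w Z :
  0 < Z -> 0 < mean_free_path D co Ro0 j w ->
  decoherence_length D co ell Ro0 j w Z ^+ 2
  = ell ^+ 2 * (3 * mean_free_path D co Ro0 j w / (2 * Z)).
Proof.
move=> Z0 S0; rewrite /decoherence_length exprMn sqr_sqrtr//.
by rewrite divr_ge0// mulr_ge0// ltW.
Qed.

End Modes.

(** * From the moment formula to the asymptotic statements *)

Lemma scaled_momentE {R : realType} {d : measure_display} {Om : measurableType d}
    (P : probability Om R) (T : R -> R -> R -> Om -> R[i]) (Ro : R -> R)
    (b S X1 X1' X2 X2' Z : R) : 0 < b -> 0 < Z ->
  second_moment P T X1 X1' X2 X2' Z = moment_kernel Ro b S X1 X1' X2 X2' Z ->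
  scaled_moment P b T X1 X1' X2 X2' Z =
  expc (- (2 * Z / S * Co_mean Ro (X1 - X2) (X1' - X2'))
        +i* phase b X1 X1' X2 X2' Z).
Proof.
move=> b0 Z0 E.
have K1 (p : R) : 0 < p -> 2 * p * Z / b * (b / (2 * p * Z)) = 1.
  by move=> p0; field; rewrite !gt_eqF.
by rewrite /scaled_moment E /moment_kernel mulrA -rmorphM/= K1 ?pi_gt0// mul1r.
Qed.

Theorem proposition5p2 (R : realType)
  (dmu : measure_display) (Omu : measurableType dmu) (Pmu : probability Omu R)
  (mu : R * R -> Omu -> R)
  (d : measure_display) (Om : measurableType d) (P : probability Om R)
  (W : R -> R -> Om -> R) (F : R -> set (set Om))
  (T : R -> R -> R -> Om -> R[i])
  (D co w0 Bw : R) (N : nat) (alpha : R -> R) (ell : R) (w : R) (j : nat) :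
  let Ro := integrated_covariance Pmu mu in
  let b := beta D co j w in
  let S := mean_free_path D co (Ro 0) j w in
  let Xd := decoherence_length D co ell (Ro 0) j w in
  let Ej := scaled_moment P b T in
  0 < D -> 0 < co -> 0 < Bw ->
  propagating_modes D co w0 Bw N alpha ->
  random_medium Pmu mu ->
  correlation Ro ell ->
  band w0 Bw w -> (1 <= j <= N)%N ->
  brownian_field P Ro W ->
  brownian_filtration P W F ->
  ito_schrodinger P W F b (q D j) (Ro 0) T ->
  (forall X1 X1' X2 X2' Z : R, 0 < Z ->
     second_moment P T X1 X1' X2 X2' Z
     = moment_kernel Ro b S X1 X1' X2 X2' Z) ->
  [/\ (* the low-SNR regime *)
      (forall G : set_system R, Filter G ->
         ((Z / mean_free_path D co (Ro 0) 1%N w0) @[Z --> G] --> +oo)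
         <-> (Z @[Z --> G] --> +oo))
      /\ Xd Z / ell @[Z --> +oo] --> (0 : R),
      (* (i) *)
      [/\ Num.sqrt (3 * S / Z) @[Z --> +oo] --> (0 : R),
          limf_esup (fun Z : R => ereal_sup
            [set r : \bar R | exists X' X1 X2 : R,
               M * ell * Num.sqrt (3 * S / Z) <= `|X1 - X2| /\
               r = (Normc.normc (Ej X1 X' X2 X' Z))%:E]) +oo
            @[M --> +oo] --> 0%E
        & ereal_sup
            [set r : \bar R | exists X' X1 X2 : R,
               r = (Normc.normc (Ej X1 X' X2 X' Z
                     - expc (- ((X1 - X2) ^+ 2 / (2 * Xd Z ^+ 2))
                             +i* phase b X1 X' X2 X' Z)))%:E]
            @[Z --> +oo] --> 0%E]
    & (* (ii) *)
      limf_esup (fun Z : R => ereal_sup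
        [set r : \bar R | exists X1 X1' X2 X2' : R,
           `|X1' - X2'| <= delta * ell /\
           r = (Normc.normc (Ej X1 X1' X2 X2' Z
                 - expc (- (((X1 - X2) ^+ 2 + (X1' - X2') ^+ 2
                             + (X1 - X2) * (X1' - X2'))
                            / (2 * Xd Z ^+ 2))
                         +i* phase b X1 X1' X2 X2' Z)))%:E]) +oo
        @[delta --> 0^'+] --> 0%E].
Proof.
move=> Ro b S Xd Ej D0 co0 Bw0 modes medium HRo ww jN _ _ _ moment.
have Roi := integrated_covariance_integrable medium.
have ell0 := correlation_length_pos HRo.
have Ro0 := correlation_pos HRo.
have /andP[j1 _] := jN.
have b0 : 0 < b by exact: beta_gt0 modes ww jN.
have S0 : 0 < S by exact: mean_free_path_gt0.
(* The central frequency lies in the band since [Bw > 0], and mode 1 propagates since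
   [1 <= j <= N]. *)
have S10 : 0 < mean_free_path D co (Ro 0) 1%N w0.
  apply: mean_free_path_gt0 => //; apply: beta_gt0 modes _ _ => //.
    by rewrite /band/= in_itv/=; apply/andP; split; lra.
  by case/andP: jN => /leq_trans h /h.
have EjE X1 X1' X2 X2' Z : 0 < Z -> Ej X1 X1' X2 X2' Z =
    expc (- (2 * Z / S * Co_mean Ro (X1 - X2) (X1' - X2'))
          +i* phase b X1 X1' X2 X2' Z).
  by move=> Z0; apply: scaled_momentE => //; exact: moment.
(* Both sides equal [Z Q / (3 S ell^2)]: the decoherence length is the one for which the Gaussian
   exponent is [l Q / (6 ell^2)] with [l = 2 Z / S]. *)
have XdE (Z Q : R) : 0 < Z -> Q / (2 * Xd Z ^+ 2) = 2 * Z / S * (Q / (6 * ell ^+ 2)).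
  move=> Z0; rewrite /Xd decoherence_length_sqr// -/S.
  by field; rewrite !gt_eqF.
have approx (e : R) : 0 < e -> exists2 r : R, 0 < r & \forall Z \near +oo,
    forall X1 X1' X2 X2', `|X1' - X2'| <= r ->
    Normc.normc (Ej X1 X1' X2 X2' Z
      - expc (- (((X1 - X2) ^+ 2 + (X1' - X2') ^+ 2 + (X1 - X2) * (X1' - X2'))
                 / (2 * Xd Z ^+ 2)) +i* phase b X1 X1' X2 X2' Z)) <= e.
  move=> /(damping_approx HRo Roi)[r r0 [L LP]]; exists r => //; near=> Z.
  have Z0 : 0 < Z by near: Z; exact/nbhs_pinfty_gt/num_real.
  move=> X1 X1' X2 X2' Xr; rewrite EjE// normc_expcB XdE//; apply: LP => //.
  rewrite ler_pdivlMr// -ler_pdivrMl//.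
(* With [X1' = X2'] the constraint on [|X1' - X2'|] holds for any radius. *)
have approx0 (e : R) : 0 < e -> \forall Z \near +oo, forall X' X1 X2,
    Normc.normc (Ej X1 X' X2 X' Z
      - expc (- ((X1 - X2) ^+ 2 / (2 * Xd Z ^+ 2)) +i* phase b X1 X' X2 X' Z)) <= e.
  move=> /approx[r r0]; apply: filterS => Z ZP X' X1 X2.
  have := ZP X1 X' X2 X'; rewrite subrr normr0 expr0n/= mulr0 !addr0.
  by apply; exact: ltW.
split.
- split; first by move=> G FG; exact: cvgy_div.
  rewrite (_ : (fun Z => Xd Z / ell) = (fun Z => Num.sqrt (3 * S / 2 / Z))).
    by apply: sqrt_div_cvg0; rewrite divr_gt0// mulr_gt0.
  apply/funext => Z; rewrite /Xd /decoherence_length mulrAC divff ?mul1r ?gt_eqF//.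
  by rewrite invfM mulrA.
- split.
  + by apply: sqrt_div_cvg0; rewrite mulr_gt0.
  + apply: cvge0_squeeze => e e0; near=> M.
    have M0 : 0 < M by near: M; exact/nbhs_pinfty_gt/num_real.
    have M1 : 1 <= M by near: M; exact/nbhs_pinfty_ge/num_real.
    (* The tolerance is split in two: [e / 2] for the Gaussian approximation, and
       [exp (- M) <= 1 / M <= e / 2] for the Gaussian itself. *)
    have Me : 2 / e <= M by near: M; exact/nbhs_pinfty_ge/num_real.
    have e20 : 0 < e / 2 by rewrite divr_gt0.
    apply/andP; split.
      apply: limf_esup_ge0 => [|Z].
        exact: filter_not_empty.
      (* A supremum over the empty set would be minus infinity; a point at exactly the threshold
         distance from 0 shows that the set is inhabited. *)
      pose X1 := M * ell * Num.sqrt (3 * S / Z).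
      apply: (@ereal_sup_mem_ge0 _ _ (Normc.normc (Ej X1 0 0 0 Z))).
        by exists 0, X1, 0; rewrite subr0 ler_norm.
      exact: normc_ge0.
    apply: limf_esup_le; near=> Z.
    have Z0 : 0 < Z by near: Z; exact/nbhs_pinfty_gt/num_real.
    apply: ge_ereal_sup => _ [X' [X1 [X2 [MX ->]]]]; rewrite lee_fin EjE// normc_expc.
    have : Normc.normc (Ej X1 X' X2 X' Z
      - expc (- ((X1 - X2) ^+ 2 / (2 * Xd Z ^+ 2)) +i* phase b X1 X' X2 X' Z)) <= e / 2.
      by move: X' X1 X2 {MX}; near: Z; exact: approx0.
    rewrite EjE// normc_expcB ler_norml => /andP[_].
    (* Since [2 Xd^2 = ell^2 (3 S / Z)], the threshold on [|X1 - X2|] makes the exponent at least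
       [M^2], and [M^2 >= M] because [M >= 1]. *)
    have : M <= (X1 - X2) ^+ 2 / (2 * Xd Z ^+ 2).
      apply: (@le_trans _ _ (M ^+ 2)); first by rewrite expr2 ler_peMl// ltW.
      have SZ0 : 0 <= 3 * S / Z by rewrite ltW// divr_gt0// mulr_gt0.
      rewrite /Xd decoherence_length_sqr// -/S.
      have X20 : 0 < 2 * (ell ^+ 2 * (3 * S / (2 * Z))).
        have ellX : 0 < ell ^+ 2 by rewrite exprn_gt0.
        have ZX : 0 < 3 * S / (2 * Z) by rewrite divr_gt0// mulr_gt0.
        by rewrite mulr_gt0// mulr_gt0.
      rewrite ler_pdivlMr//.
      rewrite [leLHS](_ : _ = (M * ell * Num.sqrt (3 * S / Z)) ^+ 2).
        rewrite -[leRHS]real_normK ?num_real//.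
        rewrite ler_pXn2r ?nnegrE//.
        by rewrite mulr_ge0 ?sqrtr_ge0// ltW// mulr_gt0.
      by rewrite exprMn sqr_sqrtr//; field; rewrite gt_eqF.
    move=> MX2; have : expR (- ((X1 - X2) ^+ 2 / (2 * Xd Z ^+ 2))) <= e / 2.
      apply: (@le_trans _ _ (expR (- M))); first by rewrite ler_expR lerN2.
      rewrite (le_trans (expRN_le_inv M0))//.
      by rewrite -[leRHS]invrK lef_pV2 ?posrE ?invr_gt0// invf_div.
    lra.
  + apply: cvge0_squeeze => e e0; apply: filterS (approx0 e e0) => Z ZP.
    apply/andP; split; last first.
      by apply: ge_ereal_sup => _ [X' [X1 [X2 ->]]]; rewrite lee_fin.
    apply: ereal_sup_mem_ge0; first by exists 0, 0, 0.
    exact: normc_ge0.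
- apply: cvge0_squeeze => e e0; have [r r0 ZP] := approx e e0.
  near=> delta.
  have d0 : 0 < delta by near: delta; exact: nbhs_right_gt.
  (* The radius [r] depends on [e] only, so [delta] can be fixed before [Z] tends to infinity. *)
  have dr : delta * ell <= r.
    rewrite -ler_pdivlMr//; near: delta; apply: nbhs_right_le.
    by rewrite divr_gt0.
  apply/andP; split.
    apply: limf_esup_ge0 => [|Z]; first exact: filter_not_empty.
    apply: ereal_sup_mem_ge0.
      by exists 0, 0, 0, 0; split; [rewrite subrr normr0 mulr_ge0// ltW|reflexivity].
    exact: normc_ge0.
  apply: limf_esup_le; apply: filterS ZP => Z ZP.
  apply: ge_ereal_sup => _ [X1 [X1' [X2 [X2' [Xd2 ->]]]]]; rewrite lee_fin.
  by apply: ZP; exact: le_trans dr.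
Unshelve. all: by end_near. Qed.
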